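(* Let $G$ be a log-divergent graph with $h_G,n_G\ge3$ and $N=N_G$ edges. Assume that for any (disjoint) subsets $I,J\subset\{1,\dots,N\}$ with $|I|<|J|$ the subquotient graph $G\backslash I/\!\!/J$ is disconnected, or is planar, or has a loop (cycle) of length at most $3$. Then $G$ is duality admissible.
   Context: Graphs are finite and may have multiple edges and self-loops. For a graph $G$ let $N_G$ be its number of edges $e_1,\dots,e_{N_G}$, $n_G=|V(G)|-1$, and $h_G=N_G-n_G$. $G$ is log-divergent if $N_G=2h_G$ (equivalently $N_G=2n_G$). $G\backslash I/\!\!/J$ denotes the graph obtained from $G$ by deleting the edges $e_i$, $i\in I$, and contracting the edges $e_j$, $j\in J$. A self-loop is a cycle of length 1 and a double edge a cycle of length 2. Dual graph polynomial: $\varphi_G=\sum_T\prod_{e\in T}\alpha_e\in\mathbb{Z}[\alpha_1,\dots,\alpha_{N_G}]$, summing over spanning trees $T$ of $G$ ($\varphi_G=0$ if $G$ is disconnected). For disjoint $I,J\subset\{1,\dots,N_G\}$ let $\varphi^J_{I}$ be the polynomial in the $N_G-|I|-|J|$ variables $\alpha_k$, $k\notin I\cup J$, obtained from $\varphi_G$ by taking the coefficient of $\prod_{j\in J}\alpha_j$ and setting $\alpha_i=0$ for $i\in I$; i.e. $\varphi^J_I=\sum_{T\supset J,\,T\cap I=\emptyset}\prod_{e\in T\setminus J}\alpha_e$. For $f\in\mathbb{Z}[a_1,\dots,a_M]$ and a prime power $q$, $[f]_q$ is the number of zeros of $f$ (reduced to $\mathbb{F}_q$) in $\mathbb{F}_q^M$.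 A log-divergent graph $G$ with $h_G,n_G\ge3$ is called duality admissible if for every prime power $q$ one has $[\varphi^J_I]_q\equiv0\bmod q^3$ (zeros counted in $\mathbb{F}_q^{N_G-|I|-|J|}$) for any disjoint $I,J\subset\{1,\dots,N_G\}$ with $|J|>|I|\ge0$ and $|I|\le n_G-3$.
   Formalization: Duality admissibility is required only for I, J leaving at least three edges outside I ∪ J; otherwise φ^J_I = 0 and the congruence mod q^3 fails for every graph (e.g. I empty, J all edges of K4). *)

(* Defs.v *)
From HB Require Import structures.
From mathcomp Require Import all_boot all_order all_algebra.
From mathcomp Require Import boolp classical_sets reals topology normedtype.
From mathcomp Require Import set_interval.
From mathcomp Require Import -(notations) mpoly.

Set Implicit Arguments.
Unset Strict Implicit.
Unset Printing Implicit Defensive.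

Import Order.TTheory GRing.Theory Num.Theory.
Import numFieldNormedType.Exports.

Local Open Scope ring_scope.

(* Finite multigraphs with self-loops.  The order of the two ends of an edge is
   an arbitrary orientation: every notion below is independent of it. *)
Record mgraph := MGraph {
  vert : finType;
  edge : finType;
  ends : edge -> vert * vert
}.

Definition nedges (G : mgraph) : nat := #|edge G|.
Definition ngr (G : mgraph) : nat := #|vert G|.-1.
Definition hgr (G : mgraph) : nat := (nedges G - ngr G)%N.

(* The subtraction in hgr is truncated; if it truncates then hgr G = 0, so this
   is harmless under the standing assumption 3 <= hgr G. *)
Definition log_divergent (G : mgraph) : Prop := nedges G = (2 * hgr G)%N.

Definition joins (G : mgraph) (e : edge G) (x y : vert G) : bool :=
  (ends e == (x, y)) || (ends e == (y, x)).

Definition adj (G : mgraph) (A : {set edge G}) : rel (vert G) :=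
  fun x y => [exists e in A, joins e x y].

Definition connected_by (G : mgraph) (A : {set edge G}) : Prop :=
  forall x y : vert G, connect (adj A) x y.

Definition connected_graph (G : mgraph) : Prop := connected_by [set: edge G].

(* A cycle [:: (v_0, e_0); ...; (v_(k-1), e_(k-1))] of length k >= 1: distinct
   vertices, distinct edges, e_i joining v_i to v_(i+1 mod k).  For k = 1 this
   is a self-loop, for k = 2 a double edge. *)
Definition is_cycle (G : mgraph) (c : seq (vert G * edge G)) : bool :=
  [&& c != [::], uniq [seq a.1 | a <- c], uniq [seq a.2 | a <- c]
    & cycle (fun a b => joins a.2 a.1 b.1) c].

Definition has_short_cycle (G : mgraph) (k : nat) : Prop :=
  exists2 c : seq (vert G * edge G), is_cycle c & (size c <= k)%N.

Definition spanning_tree (G : mgraph) (T : {set edge G}) : Prop :=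
  connected_by T /\
  forall c : seq (vert G * edge G),
    is_cycle c -> ~ {subset [seq a.2 | a <- c] <= T}.

(* G \ I // J: the edges are those outside I and J, the vertices are the
   connected components of the spanning subgraph (V(G), J). *)
Definition jclass (G : mgraph) (J : {set edge G}) (x : vert G) :
    {set vert G} := [set y | connect (adj J) x y].

Definition sq_vert (G : mgraph) (J : {set edge G}) : finType :=
  {B : {set vert G} | B \in [set jclass J x | x in [set: vert G]]}.

Definition sq_edge (G : mgraph) (I J : {set edge G}) : finType :=
  {e : edge G | e \notin I :|: J}.

Definition sq_proj (G : mgraph) (J : {set edge G}) (x : vert G) : sq_vert J :=
  exist _ (jclass J x) (imset_f (jclass J) (finset.in_setT x)).

Definition subquotient (G : mgraph) (I J : {set edge G}) : mgraph :=
  @MGraph (sq_vert J) (sq_edge I J)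
    (fun e => (sq_proj J (ends (sval e)).1, sq_proj J (ends (sval e)).2)).

(* A drawing in the plane: distinct points for the vertices, and for each edge a
   continuous curve between the points of its ends; the open curves are simple,
   pairwise disjoint and avoid the points of the vertices. *)
Definition plane_drawing (R : realType) (G : mgraph)
    (p : vert G -> R * R) (g : edge G -> R -> R * R) : Prop :=
  [/\ injective p,
      forall e, {within `[0, 1], continuous (g e)}%classic,
      forall e, g e 0 = p (ends e).1 /\ g e 1 = p (ends e).2,
      forall e f (s t : R), 0 < s < 1 -> 0 < t < 1 ->
        g e s = g f t -> e = f /\ s = t
    & forall e v (s : R), 0 < s < 1 -> g e s <> p v].

Definition planar (R : realType) (G : mgraph) : Prop :=
  exists (p : vert G -> R * R) (g : edge G -> R -> R * R), plane_drawing p g.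

(* phi^J_I = \sum_(T >= J, T :&: I = 0) \prod_(e in T :\: J) alpha_e; the k-th
   variable is alpha_e for e the k-th edge outside I and J.  The dual graph
   polynomial phi_G itself is the case I = J = set0. *)
Definition dual_poly (G : mgraph) (I J : {set edge G}) :
    mpoly #|~: (I :|: J)| int :=
  \sum_(T : {set edge G} | [&& `[< spanning_tree T >], J \subset T
                             & [disjoint T & I]])
    \prod_(k < #|~: (I :|: J)| | enum_val k \in T)
      (mpolyX int (mnm1 k) : mpoly _ int).

(* [f]_q for q = #|F|. *)
Definition nzeros (F : finFieldType) (M : nat) (f : mpoly M int) : nat :=
  #|[set a : {ffun 'I_M -> F} |
      meval a (map_mpoly (intr : int -> F) f) == 0]|.

(* The condition 3 <= #|~: (I :|: J)| only discards pairs for which the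
   congruence fails for every G: if fewer than three variables remain, then
   #|I| <= ngr G - 3 forces #|J| > ngr G, the degree of phi_G, so that phi^J_I
   is the zero polynomial and has q ^ #|~: (I :|: J)| zeros. *)
Definition duality_admissible (G : mgraph) : Prop :=
  [/\ log_divergent G, (3 <= hgr G)%N, (3 <= ngr G)%N
    & forall (F : finFieldType) (I J : {set edge G}),
        [disjoint I & J] -> (#|I| < #|J|)%N -> (#|I| <= ngr G - 3)%N ->
        (3 <= #|~: (I :|: J)|)%N ->
        (#|F| ^ 3 %| nzeros F (dual_poly I J))%N].

(* Main.v *)
Require Import Defs.
From mathcomp Require Import all_boot all_order all_algebra.
From mathcomp Require Import reals.
From mathcomp Require Import perm mxabelem boolp zify.
From mathcomp Require Import -(notations) mpoly.

Set Implicit Arguments.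
Unset Strict Implicit.
Unset Printing Implicit Defensive.

Import GRing.Theory.
Local Open Scope ring_scope.

(** Let [n = ngr G].  If no spanning tree contains [J], then [phi^J_I = 0].
Otherwise take coordinates of the grounded incidence vectors of the edges in the
basis given by such a tree, and drop the coordinates indexed by [J].  With
[m = n - #|J|] and [M = 2n - #|I| - #|J|] variables, the matrix-tree theorem
gives [phi^J_I (a) = \det (W^T diag(a) W)] for an [M x m] matrix [W], and the
hypotheses say [M >= 2m + 1] and [M >= m + 3].

Put [Q a = W^T diag(a) W] and let [u a] be the number of [x] with [x Q(a) = 0],
a power of [q].  For fixed [x] the condition [x Q(a) = 0] is linear in [a] of
rank at most [m], so [q^3] divides [\sum_a (u a - 1)].  For fixed [x != 0] and
[y], the condition [x Q(a) = y Q(a) = 0] has rank at most [2m - 1] because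
[Q a] is symmetric, and depends on [y] only modulo [x], so [q^3] divides
[\sum_a (u a - 1) u a].  As [u (u - 1) = (q - 1) u + u (u - q)], and [q^3]
divides [u (u - q)] when [q] divides [u], both [\sum u a] and [\sum (u a - 1)]
over the singular [Q a] are divisible by [q^3], hence so is the number of
singular [Q a]. *)

(** * Counting the [a] for which [W^T diag(a) W] is singular *)

Section SingularCount.

Variable F : finFieldType.
Let q := #|F|.

Lemma card_kermx m n (A : 'M[F]_(m, n)) :
  #|[set u : 'rV_m | u *m A == 0]| = (q ^ (m - \rank A))%N.
Proof.
have -> : [set u : 'rV_m | u *m A == 0] = rowg (kermx A).
  by apply/setP=> u; rewrite !inE sub_kermx.
by rewrite card_rowg mxrank_ker.
Qed.

Lemma row_mul_diag_mxC n (u v : 'rV[F]_n) : u *m diag_mx v = v *m diag_mx u.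
Proof. by apply/rowP=> i; rewrite !mul_mx_diag !mxE mulrC. Qed.

Variables (M m : nat) (W : 'M[F]_(M, m)).
Hypotheses (ltmM : (2 * m < M)%N) (lem3M : (m + 3 <= M)%N).

Let Q (a : 'rV[F]_M) := W^T *m diag_mx a *m W.
Let D (x : 'rV[F]_m) := diag_mx (x *m W^T) *m W.
Let ker (a : 'rV[F]_M) := #|[set x : 'rV[F]_m | x *m Q a == 0]|.

Let mulQ x a : x *m Q a = a *m D x.
Proof. by rewrite /Q /D !mulmxA row_mul_diag_mxC. Qed.

Let kerE a : ker a = (q ^ (m - \rank (Q a)))%N.
Proof. exact: card_kermx. Qed.

Let det_eq0 a : (\det (Q a) == 0) = (0 < m - \rank (Q a))%N.
Proof.
rewrite subn_gt0 ltn_neqAle rank_leq_row andbT.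
by rewrite -[_ == m]/(row_free (Q a)) row_free_unit unitmxE unitfE negbK.
Qed.

Let dvd_count1 (x : 'rV[F]_m) : (q ^ 3 %| #|[set a | x *m Q a == 0%R]|)%N.
Proof.
under eq_finset do rewrite mulQ.
rewrite card_kermx dvdn_exp2l //.
by have := rank_leq_col (D x); lia.
Qed.

Let dvd_count2 (x y : 'rV[F]_m) : x != 0 ->
  (q ^ 2 %| #|[set a | (x *m Q a == 0%R) && (y *m Q a == 0%R)]|)%N.
Proof.
move=> nz_x; pose A := row_mx (D x) (D y).
have -> : [set a | (x *m Q a == 0) && (y *m Q a == 0)] = [set a | a *m A == 0].
  apply/setP=> a; rewrite !inE !mulQ mul_mx_row.
  apply/andP/eqP => [[/eqP-> /eqP->]|]; first by rewrite row_mx0.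
  by rewrite -(row_mx0 F 1 m m) => /eq_row_mx[-> ->]; rewrite eqxx.
rewrite card_kermx dvdn_exp2l //.
suff: (\rank A < m + m)%N by lia.
rewrite ltn_neqAle rank_leq_col andbT; apply/negP => /row_fullP[B BA].
(* The symmetry [x Q(a) y^T = y Q(a) x^T] puts this column in the right kernel of [A]; full column
   rank would make it zero, hence also [x]. *)
have Ac0 : A *m col_mx y^T (- x^T) = 0.
  rewrite mul_row_col mulmxN /D -!mulmxA.
  apply/eqP; rewrite subr_eq0; apply/eqP.
  apply/colP=> k; rewrite !mul_diag_mx !mxE.
  rewrite mulrC; congr (_ * _); apply: eq_bigr => i _; rewrite !mxE mulrC //.
have : col_mx y^T (- x^T) = 0 by rewrite -[LHS]mul1mx -BA -mulmxA Ac0 mulmx0.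
rewrite -(col_mx0 F m m 1) => /eq_col_mx[_ /eqP].
by rewrite oppr_eq0 trmx_eq0 (negPf nz_x).
Qed.

(* The summand is invariant under [y |-> y + c *: x], which supplies one more
   factor [q] than the summandwise bound. *)
Let dvd_sum2 (x : 'rV[F]_m) : x != 0 ->
  (q ^ 3 %| \sum_(y : 'rV[F]_m)
      #|[set a | (x *m Q a == 0%R) && (y *m Q a == 0%R)]|)%N.
Proof.
move=> nz_x; have /rV0Pn[i nz_xi] := nz_x.
(* The fibre of ratio [c] is the translate by [c *: x] of the fibre [y 0 i = 0], so the total
   consists of [q] equal sums. *)
rewrite (partition_big (fun y : 'rV_m => y 0 i / x 0 i) predT) //=.
rewrite (eq_bigr (fun=> (\sum_(y : 'rV[F]_m | y 0%R i == 0%R)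
   #|[set a | (x *m Q a == 0%R) && (y *m Q a == 0%R)]|)%N)) => [|c _].
  rewrite sum_nat_const expnS dvdn_mul //.
  by apply: dvdn_sum => y _; apply: dvd_count2.
rewrite (reindex_inj (addIr (c *: x))) /=; apply: eq_big => y.
  rewrite !mxE mulrDl mulfK // -subr_eq0 addrK mulf_eq0 invr_eq0.
  by rewrite (negPf nz_xi) orbF.
move=> _; apply: eq_card => a; rewrite !inE mulmxDl -scalemxAl.
by case: eqP => //= ->; rewrite scaler0 addr0.
Qed.

Let sum_ker1 : (q ^ 3 %| \sum_a (ker a - 1))%N.
Proof.
have -> : (\sum_a (ker a - 1) =
    \sum_(x : 'rV[F]_m | x != 0%R) #|[set a | x *m Q a == 0%R]|)%N.
  under [RHS]eq_bigr do rewrite -sum1dep_card big_mkcond.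
  rewrite exchange_big; apply: eq_bigr => a _ /=.
  rewrite /ker (cardsD1 0) inE mul0mx eqxx addnC addnK -sum1_card.
  by rewrite -big_mkcondr; apply: eq_bigl => x; rewrite !inE.
by apply: dvdn_sum => x _; apply: dvd_count1.
Qed.

Let sum_ker2 : (q ^ 3 %| \sum_a (ker a - 1) * ker a)%N.
Proof.
have -> : (\sum_a (ker a - 1) * ker a =
    \sum_(x : 'rV[F]_m | x != 0%R) \sum_(y : 'rV[F]_m)
       #|[set a | (x *m Q a == 0%R) && (y *m Q a == 0%R)]|)%N.
  under [RHS]eq_bigr do
    (under eq_bigr do rewrite -sum1dep_card big_mkcond; rewrite exchange_big).
  rewrite exchange_big; apply: eq_bigr => a _ /=.
  rewrite /ker {1}(cardsD1 0) inE mul0mx eqxx addnC addnK.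
  rewrite -sum1_card big_distrl /=.
  rewrite (eq_bigl (fun x : 'rV_m => (x != 0) && (x *m Q a == 0))); last first.
    by move=> x; rewrite !inE.
  rewrite big_mkcondr; apply: eq_bigr => x _.
  case: ifP => _ /=; last by rewrite big1.
  by rewrite mul1n -big_mkcond sum1dep_card.
by apply: dvdn_sum => x; apply: dvd_sum2.
Qed.

Lemma card_singular_dvd :
  (q ^ 3 %| #|[set a : 'rV[F]_M | \det (W^T *m diag_mx a *m W) == 0%R]|)%N.
Proof.
pose sing a := \det (Q a) == 0.
have q_gt1 : (1 < q)%N by rewrite /q card_finNzRing_gt1.
have ker1 a : ~~ sing a -> ker a = 1%N.
  by rewrite /sing det_eq0 -eqn0Ngt kerE => /eqP->.
have toSing (f : nat -> nat) : (\sum_a (ker a - 1) * f (ker a) =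
    \sum_(a | sing a) (ker a - 1) * f (ker a))%N.
  by rewrite (bigID sing) /= [X in (_ + X)%N]big1 ?addn0 // => a /ker1->.
have := sum_ker2; rewrite (toSing id) /= => h2.
have := sum_ker1; under eq_bigr do rewrite -[(_ - 1)%N]muln1.
rewrite (toSing (fun=> 1%N)); under eq_bigr do rewrite muln1.
move=> h1.
(* As [q - 1] is prime to [q], it suffices to treat [(q - 1) u], the difference of [u (u - 1)] and
   [u (u - q)]. *)
have h3 : (q ^ 3 %| \sum_(a | sing a) ker a)%N.
  have cop : coprime (q ^ 3) (q - 1).
    by rewrite coprimeXl // subn1 coprimenP //; lia.
  rewrite -(Gauss_dvdr _ cop) big_distrr /=.
  have dd : (q ^ 3 %| \sum_(a | sing a) ker a * (ker a - q))%N.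
    apply: dvdn_sum => a; rewrite /sing det_eq0 kerE.
    (* Here [u = q ^ k] with [k > 0]: for [k = 1] the factor [u - q] vanishes, for [k = 2] it
       supplies the third [q], and for [k >= 3] the factor [u] suffices. *)
    case: (_ - _)%N => [|[|[|k]]] // _.
    - by rewrite expn1 subnn muln0 dvdn0.
    - rewrite [(q ^ 3)%N]expnSr dvdn_mul // dvdn_sub ?dvdnn //.
      by rewrite expnS dvdn_mulr.
    - by rewrite dvdn_mulr // dvdn_exp2l.
  rewrite -(dvdn_addl _ dd) -big_split /=.
  rewrite (eq_bigr (fun a => (ker a - 1) * ker a)%N) // => a.
  rewrite /sing det_eq0 kerE => k_gt0.
  (* The bound [q <= u] keeps the truncated subtraction [u - q] exact. *)
  have : (q <= q ^ (m - \rank (Q a)))%N by rewrite -{1}[q]expn1 leq_exp2l.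
  move: (q ^ _)%N => u leqqu.
  rewrite [LHS]addnC [((q - 1) * u)%N]mulnC -mulnDr mulnC.
  by congr (_ * _)%N; lia.
have -> : #|[set a | sing a]| = (\sum_(a | sing a) ker a -
    \sum_(a | sing a) (ker a - 1))%N.
  rewrite -sumnB => [|a _]; last by rewrite leq_subr.
  rewrite -sum1dep_card; apply: eq_bigr => a _.
  by rewrite subKn // kerE expn_gt0; lia.
exact: dvdn_sub.
Qed.

End SingularCount.

(** * Cauchy-Binet for weighted Gram determinants *)

Section CauchyBinet.

Variable R : comNzRingType.

Lemma det_mulmx_ffun m n (A : 'M[R]_(m, n)) (B : 'M[R]_(n, m)) :
  \det (A *m B) =
    \sum_(f : {ffun 'I_m -> 'I_n}) \det (rowsub f B) * \prod_i A i (f i).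
Proof.
pose AB (s : 'S_m) i k := A i k * B k (s i).
transitivity (\sum_(f : {ffun 'I_m -> 'I_n}) \sum_(s : 'S_m)
    (-1) ^+ s * \prod_i AB s i (f i)).
  rewrite exchange_big; apply: eq_bigr => /= s _; rewrite -big_distrr /=.
  congr (_ * _); rewrite -(bigA_distr_bigA (AB s)) /=.
  by apply: eq_bigr => x _; rewrite mxE.
apply: eq_bigr => f _; rewrite mulrC big_distrr /=; apply: eq_bigr => s _.
rewrite mulrCA big_split //=; congr (_ * (_ * _)).
by apply: eq_bigr => x _; rewrite mxE.
Qed.

Lemma det_rowsub_noninj m n (B : 'M[R]_(n, m)) (f : 'I_m -> 'I_n) :
  ~~ injectiveb f -> \det (rowsub f B) = 0.
Proof.
case/injectivePn=> i1 [i2 Di12 Ef12].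
by apply: (determinant_alternate Di12) => j; rewrite !mxE Ef12.
Qed.

(* The squared maximal minors of [W] are passed as a function [d] of the set of
   chosen rows, which spares choosing an enumeration of each such set. *)
Lemma det_gram m n (W : 'M[R]_(n, m)) (a : 'rV[R]_n) (d : {set 'I_n} -> R) :
  (forall g : 'I_m -> 'I_n, injective g ->
     \det (rowsub g W) ^+ 2 = d [set g i | i : 'I_m]) ->
  \det (W^T *m diag_mx a *m W) =
    \sum_(S : {set 'I_n} | #|S| == m) d S * \prod_(k in S) a 0 k.
Proof.
move=> dP; rewrite det_mulmx_ffun (bigID (fun f : {ffun _} => injectiveb f)) /=.
rewrite [X in _ + X]big1 ?addr0 => [|f /det_rowsub_noninj->]; last first.
  by rewrite mul0r.
pose im (f : {ffun 'I_m -> 'I_n}) := [set f i | i : 'I_m].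
rewrite (partition_big im (fun S => #|S| == m)) /=; last first.
  by move=> f /injectiveP inj_f; rewrite /im card_imset ?card_ord.
apply: eq_bigr => S /eqP cardS.
pose g i := enum_val (cast_ord (esym cardS) i).
have inj_g : injective g by move=> i j /enum_val_inj/cast_ord_inj.
have imgS : [set g i | i : 'I_m] = S.
  apply/eqP; rewrite eqEcard card_imset // card_ord cardS leqnn andbT.
  by apply/subsetP=> _ /imsetP[i _ ->]; apply: enum_valP.
(* The injections with image [S] are the reorderings [h s] of the enumeration [g], and [k] recovers
   the permutation; its default values are never reached on them. *)
pose h (s : 'S_m) := [ffun i => g (s i)].
pose k (f : {ffun 'I_m -> 'I_n}) : 'S_m :=
  insubd (1%g : 'S_m) [ffun i => odflt i [pick j | g j == f i]].
have kP (f : {ffun 'I_m -> 'I_n}) :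
    injectiveb f && (im f == S) -> forall i, g (k f i) = f i.
  case/andP=> /injectiveP inj_f /eqP imf.
  have pickP i : g (odflt i [pick j | g j == f i]) = f i.
    case: pickP => [j /eqP // | no_j].
    have: f i \in S by rewrite -imf imset_f.
    by rewrite -imgS => /imsetP[j _ Dj]; have:= no_j j; rewrite Dj eqxx.
  move=> i; rewrite -[RHS]pickP; congr g.
  rewrite /k -pvalE insubdK ?ffunE // unfold_in /=.
  by apply/injectiveP=> i1 i2; rewrite !ffunE => /(congr1 g);
    rewrite !pickP => /inj_f.
rewrite (reindex h) /=; last first.
  exists k => [s | f] Hs.
    by apply/permP=> i; apply: inj_g; rewrite kP // ffunE.
  by apply/ffunP=> i; rewrite ffunE kP.
pose A := rowsub g W; pose c := \det A * \prod_(l in S) a 0 l.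
have -> : d S = \det A * \det A^T by rewrite det_tr -expr2 -imgS -dP.
(* The signs of the reordered minors assemble into the Leibniz expansion of [\det A^T]. *)
transitivity (\sum_(s : 'S_m) c * ((-1) ^+ s * \prod_i A^T i (s i)));
  last first.
  by rewrite -big_distrr /= -/(determinant _) mulrAC.
apply: eq_big => [s | s _].
  have inj_hs : injective (h s).
    by move=> i j; rewrite !ffunE => /inj_g/perm_inj.
  rewrite (introT (injectiveP _) inj_hs) /= eqEcard card_imset // card_ord.
  rewrite cardS leqnn andbT; apply/subsetP=> _ /imsetP[i _ ->].
  by rewrite ffunE enum_valP.
have -> : \det (rowsub (h s) W) = (-1) ^+ s * \det A.
  rewrite -det_perm -det_mulmx -row_permE; congr (\det _).
  by apply/matrixP=> i j; rewrite !mxE ffunE.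
rewrite {}/c; have -> : \prod_(l in S) a 0 l = \prod_i a 0 (h s i).
  rewrite -imgS big_imset /=; last by move=> i j _ _ /inj_g.
  rewrite (reindex_perm s) /=; apply: eq_bigr => i _.
  by rewrite ffunE.
rewrite (eq_bigr (fun i => A^T i (s i) * a 0 (h s i))) => [|i _]; last first.
  by rewrite mul_mx_diag !mxE ffunE.
by rewrite big_split /= mulrACA mulrC.
Qed.

End CauchyBinet.

(** * Connectivity, cycles and minimality of spanning trees *)

Section Trees.

Variable G : mgraph.
Implicit Types (T A : {set edge G}) (x y : vert G) (e : edge G).

Lemma joinsC e x y : joins e x y = joins e y x.
Proof. by rewrite /joins orbC. Qed.

Lemma adj_connect_sym A : connect_sym (adj A).
Proof.
apply: sym_connect_sym => x y; rewrite /adj.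
by under eq_existsb => e do rewrite joinsC.
Qed.

Let link (a b : vert G * edge G) := joins a.2 a.1 b.1.

Lemma path_link_connect A a c :
  path link a c -> {subset [seq b.2 | b <- belast a c] <= A} ->
  connect (adj A) a.1 (last a c).1.
Proof.
elim: c a => [|b c IHc] a //= /andP[ab bc] sA.
apply: (connect_trans (y := b.1)); last first.
  by apply: IHc => // e ce; apply: sA; rewrite inE ce orbT.
by apply/connect1/existsP; exists a.2; rewrite sA ?mem_head.
Qed.

(** The rest of the cycle still joins the ends of its first edge (for a self-loop they coincide), so
    every walk can avoid that edge. *)
Lemma connected_remove_cycle_edge T c :
  connected_by T -> is_cycle c -> {subset [seq a.2 | a <- c] <= T} ->
  exists2 e, e \in T & connected_by (T :\ e).
Proof.
case: c => [|[x0 e0] c] // connT /and4P[_ _ uniq_e cyc] sT.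
exists e0; first by apply: sT; rewrite mem_head.
have conn0 x y : joins e0 x y -> connect (adj (T :\ e0)) x y.
  have connE y1 : joins e0 x0 y1 -> connect (adj (T :\ e0)) x0 y1 ->
      joins e0 x y -> connect (adj (T :\ e0)) x y.
    rewrite /joins => /orP[] /eqP-> con /orP[] /eqP[<- <-] //;
    by rewrite adj_connect_sym.
  case: c cyc uniq_e sT => [|b c] /=.
    by rewrite andbT /= => j00 _ _; apply: (connE x0).
  case/andP=> j0b pathc /andP[]; rewrite inE negb_or => /andP[ne0b e0c] _ sT.
  apply: (connE b.1) => //; rewrite adj_connect_sym.
  (* Appending [(x0, e0)] leads the path back to [x0]; [belast] drops this pair, so only the edges
     of [b :: c] are traversed. *)
  have := @path_link_connect (T :\ e0) b (rcons c (x0, e0)) pathc.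
  rewrite last_rcons belast_rcons; apply=> e ce.
  have ce0 : e \in b.2 :: [seq a.2 | a <- c] := ce.
  rewrite !inE (sT e) ?inE ?andbT; last first.
    by move: ce0; rewrite inE => ->; rewrite orbT.
  apply: contraTneq ce0 => ->; by rewrite inE negb_or ne0b.
move=> x y; apply: connect_sub (connT x y) => u v /existsP[e /andP[eT juv]].
have [eqe|ne_e] := eqVneq e e0; first by apply: conn0; rewrite -eqe.
by apply/connect1/existsP; exists e; rewrite !inE ne_e eT.
Qed.

(** Puts a simple vertex path in the format of [is_cycle], with [e] as the prospective closing edge.
    The first edge cannot recur: it has [x] as an end, while all later edges of the path have both
    ends on its remainder. *)
Lemma simple_path_link A e x p : path (adj A) x p -> uniq (x :: p) ->
  exists f c es,
    [/\ [seq a.1 | a <- c] = p, path link (x, f) c,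
        last (x, f) c = (last x p, e),
        f :: [seq a.2 | a <- c] = rcons es e &
        uniq es /\ {in es, forall e', [/\ e' \in A, (ends e').1 \in x :: p
                             & (ends e').2 \in x :: p]}].
Proof.
elim: p x => [|y p IHp] x /=; first by exists e, [::], [::]; split.
case/andP=> /existsP[e1 /andP[e1A j1]] pathp /andP[xp uniqp].
have [f [c [es [Dp pc Dl De [ues esP]]]]] := IHp y pathp uniqp.
exists e1, ((y, f) :: c), (e1 :: es); split=> //=.
- by rewrite Dp.
- by rewrite /link /= j1.
- by rewrite De.
split.
  rewrite ues andbT; apply: contra xp => /esP[_].
  by case/orP: j1 => /eqP-> /=.
move=> e'; rewrite inE => /predU1P[->|/esP[-> e'1 e'2]]; last first.
  by rewrite ![_ \in x :: _]inE e'1 e'2 !orbT.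
by rewrite e1A; case/orP: j1 => /eqP-> /=; rewrite !inE !eqxx !orbT.
Qed.

(** A simple path joining the ends of [e] inside [T :\ e] would close up with [e] to a cycle in
    [T]. *)
Lemma spanning_tree_minimal T e :
  spanning_tree T -> e \in T -> ~ connected_by (T :\ e).
Proof.
move=> [_ acyT] eT /(_ (ends e).2 (ends e).1) /connectP[p0 path0 last0].
case: (shortenP path0) last0 => p pathp uniqp _ Dlast.
have [f [c [es [Dp pc Dl De [ues esP]]]]] := simple_path_link e pathp uniqp.
apply: (acyT ((((ends e).2, f)) :: c)).
  rewrite /is_cycle /=; apply/and3P; split; first by rewrite Dp.
  - rewrite -/(uniq (f :: _)) De rcons_uniq ues andbT.
    by apply/negP=> /esP[]; rewrite !inE eqxx.
  rewrite rcons_path pc Dl /= /link /= -Dlast /joins.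
  by rewrite -surjective_pairing eqxx.
move=> e' /=; rewrite -/(e' \in (f :: _)) De mem_rcons inE => /predU1P[-> //|].
by case/esP; rewrite inE => /andP[].
Qed.

End Trees.

(** * Reduced incidence matrices and their maximal minors *)

Section Incidence.

Variables (G : mgraph) (n : nat) (p : vert G -> 'I_n.+1).
Hypothesis bij_p : bijective p.
Implicit Types (T : {set edge G}) (x y : vert G) (e : edge G).

Section Ring.

Variable R : comNzRingType.

(* The vertex numbered [0] is the grounded one: its vector is zero. *)
Definition vvec x : 'rV[R]_n := \row_i (p x == lift ord0 i)%:R.
Definition evec e : 'rV[R]_n := vvec (ends e).1 - vvec (ends e).2.
Definition incmx k (g : 'I_k -> edge G) : 'M[R]_(k, n) := \matrix_i evec (g i).

Let inspan T (v : 'rV[R]_n) :=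
  exists c : edge G -> R, v = \sum_(e in T) c e *: evec e.

Let inspanD T u v : inspan T u -> inspan T v -> inspan T (u + v).
Proof.
move=> [c ->] [d ->]; exists (fun e => c e + d e).
by rewrite -big_split; apply: eq_bigr => e _; rewrite scalerDl.
Qed.

Let inspan_edge T e c : e \in T -> inspan T (c *: evec e).
Proof.
move=> eT; exists (fun e' => if e' == e then c else 0).
rewrite (bigD1 e) //= eqxx big1 ?addr0 // => e' /andP[_ /negPf->].
by rewrite scale0r.
Qed.

Let inspan_connect T x y : connect (adj T) x y -> inspan T (vvec x - vvec y).
Proof.
case/connectP=> s; elim: s x => [|z s IHs] x /=.
  move=> _ ->; exists (fun=> 0); rewrite subrr big1 // => e _.
  by rewrite scale0r.
case/andP=> /existsP[e /andP[eT jxz]] /IHs{}IHs /IHs{}IHs.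
rewrite -(subrK (vvec z) (vvec x)) -addrA; apply: inspanD => //.
case/orP: jxz => /eqP De.
  have -> : vvec x - vvec z = 1 *: evec e by rewrite scale1r /evec De.
  exact: inspan_edge.
have -> : vvec x - vvec z = -1 *: evec e by rewrite scaleN1r /evec De opprB.
exact: inspan_edge.
Qed.

(** Along a path to the grounded vertex the edge vectors telescope, and the grounded vector is
    zero. *)
Lemma connected_span T x : connected_by T ->
  exists c : edge G -> R, vvec x = \sum_(e in T) c e *: evec e.
Proof.
move=> connT; have [p' pK p'K] := bij_p.
have := inspan_connect (connT x (p' ord0)).
have -> : vvec (p' ord0) = 0.
  by apply/rowP=> i; rewrite !mxE p'K (negPf (neq_lift _ _)).
by rewrite subr0.
Qed.

Lemma connected_incmx_linv T k (g : 'I_k -> edge G) :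
  connected_by T -> injective g -> [set g i | i : 'I_k] = T ->
  exists X : 'M[R]_(n, k), X *m incmx g = 1%:M.
Proof.
move=> connT inj_g imgT; have [p' pK p'K] := bij_p.
have /(_ _)/cid-/all_sig[c cP] :=
  fun i : 'I_n => connected_span (p' (lift ord0 i)) connT.
exists (\matrix_(i, j) c i (g j)).
apply/row_matrixP=> i; rewrite row_mul mulmx_sum_row.
have -> : row i 1%:M = vvec (p' (lift ord0 i)).
  by apply/rowP=> j; rewrite !mxE p'K (inj_eq lift_inj).
rewrite cP -imgT big_imset /=; last by move=> ? ? _ _ /inj_g.
by apply: eq_bigr => j _; rewrite rowK !mxE.
Qed.

(** The potential is the indicator of a component missing the grounded vertex: it is constant along
    the edges of [T], and its value 0 at the ground agrees with the zero vector there. *)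
Lemma disconnected_potential T : ~ connected_by T ->
  exists2 z : 'cV[R]_n, {in T, forall e, evec e *m z = 0}
                      & exists x, vvec x *m z = 1%:M.
Proof.
move=> /existsNP[x1 /existsNP[x2 nc12]]; have [p' pK p'K] := bij_p.
have [x ncx] : exists x, ~~ connect (adj T) x (p' ord0).
  apply: contrapT => /forallNP ncon; apply: nc12.
  apply: (connect_trans (y := p' ord0)); last rewrite adj_connect_sym.
    by have /negP := ncon x1; rewrite negbK.
  by have /negP := ncon x2; rewrite negbK.
pose ind y : R := (connect (adj T) x y)%:R.
pose z : 'cV[R]_n := \col_i ind (p' (lift ord0 i)).
have zP y : vvec y *m z = (ind y)%:M.
  apply/matrixP=> i j; rewrite !ord1 !mxE eqxx mulr1n.
  have [k Dk|Dy] := unliftP ord0 (p y).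
    rewrite (bigD1 k) //= !mxE Dk eqxx mul1r -Dk pK big1 ?addr0 //.
    by move=> l nlk; rewrite !mxE Dk (inj_eq lift_inj) eq_sym (negPf nlk) mul0r.
  rewrite big1 => [|k _]; last first.
    by rewrite !mxE Dy (negPf (neq_lift _ _)) mul0r.
  by rewrite /ind -[y]pK Dy (negPf ncx).
exists z; last by exists x; rewrite zP /ind connect0.
move=> e eT; rewrite mulmxBl !zP /ind.
suff -> : connect (adj T) x (ends e).1 = connect (adj T) x (ends e).2.
  by rewrite subrr.
apply: same_connect_r; first exact: adj_connect_sym.
apply/connect1/existsP; exists e.
by rewrite eT /joins -surjective_pairing eqxx.
Qed.

End Ring.

Lemma map_incmx (R S : comNzRingType) (f : {rmorphism R -> S}) k
  (g : 'I_k -> edge G) : map_mx f (incmx R g) = incmx S g.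
Proof. by apply/matrixP=> i j; rewrite !mxE rmorphB /= !rmorph_nat. Qed.

(** In the connected case an integral left inverse makes the determinant a unit, hence [1] or [-1].
    Otherwise a potential taking the value 1 lies in the kernel, and the adjugate forces determinant
    0. *)
Lemma det_incmx_sqr_int (g : 'I_n -> edge G) : injective g ->
  \det (incmx int g) ^+ 2 = `[< connected_by [set g i | i : 'I_n] >]%:R.
Proof.
move=> inj_g; case: asboolP => [connT | nconnT].
  have [X XB] := connected_incmx_linv int connT inj_g erefl.
  have /(congr1 determinant) := XB; rewrite det_mulmx det1.
  by move=> /intUnitRing.unitzPl/orP[] /eqP->; rewrite ?sqrrN expr1n.
have [z zP [x zx]] := disconnected_potential int nconnT.
have Bz : incmx int g *m z = 0.
  apply/row_matrixP=> i; rewrite row_mul rowK row0 zP //.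
  by rewrite imset_f.
have : \adj (incmx int g) *m (incmx int g *m z) = 0 by rewrite Bz mulmx0.
rewrite mulmxA mul_adj_mx mul_scalar_mx => dz.
have : vvec int x *m (\det (incmx int g) *: z) = 0 by rewrite dz mulmx0.
rewrite -scalemxAr zx scale_scalar_mx mulr1 => /matrixP/(_ 0 0).
by rewrite !mxE eqxx mulr1n => ->; rewrite expr0n.
Qed.

Lemma connected_card_ge T : connected_by T -> (n <= #|T|)%N.
Proof.
move=> connT.
have imT : [set (enum_val i : edge G) | i : 'I_#|T|] = T.
  apply/setP=> e; apply/imsetP/idP => [[i _ ->]|eT]; first exact: enum_valP.
  by exists (enum_rank_in eT e); rewrite ?enum_rankK_in.
have [X /(congr1 mxrank)] :=
  connected_incmx_linv rat connT (@enum_val_inj _ (mem T)) imT.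
by rewrite mxrank1 => <-; apply: leq_trans (mxrankM_maxr _ _) (rank_leq_row _).
Qed.

(** More than [n] edges would satisfy a linear relation involving some edge. A potential for [T]
    without that edge kills the other edges, hence by the relation this one too, against
    connectedness of [T]. *)
Lemma spanning_tree_card T : spanning_tree T -> #|T| = n.
Proof.
move=> treeT; have [connT _] := treeT; apply/eqP.
rewrite eqn_leq connected_card_ge // andbT leqNgt; apply/negP => ltnT.
pose A := incmx rat (fun i : 'I_#|T| => enum_val i).
have /rowV0Pn[u /sub_kermxP uA nz_u] : kermx A != 0.
  by rewrite -mxrank_eq0 mxrank_ker; have := rank_leq_col A; lia.
have /rV0Pn[i nz_ui] := nz_u.
have /(disconnected_potential rat)[z zP [x zx]] :=
  spanning_tree_minimal treeT (enum_valP i).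
have zi : evec rat (enum_val i) *m z = 0.
  have: u *m (A *m z) = 0 by rewrite mulmxA uA mul0mx.
  rewrite mulmx_sum_row (bigD1 i) //= big1 ?addr0 => [|k nki].
    by rewrite row_mul rowK => /eqP; rewrite scaler_eq0 (negPf nz_ui) => /eqP.
  rewrite row_mul rowK zP ?scaler0 //.
  by rewrite !inE enum_valP (inj_eq enum_val_inj) nki.
have [c cx] := connected_span rat x connT.
have : vvec rat x *m z = 0.
  rewrite cx mulmx_suml big1 // => e eT; rewrite -scalemxAl.
  have [->|nei] := eqVneq e (enum_val i); first by rewrite zi scaler0.
  by rewrite zP ?scaler0 // !inE nei.
by rewrite zx => /eqP; rewrite -mxrank_eq0 mxrank1.
Qed.

(** Removing an edge of a cycle would leave a connected set of fewer than [n] edges. *)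
Lemma connected_spanning_tree T :
  connected_by T -> #|T| = n -> spanning_tree T.
Proof.
move=> connT cardT; split=> // c cyc sT.
have [e eT /connected_card_ge] := connected_remove_cycle_edge connT cyc sT.
by have := cardsD1 e T; rewrite eT cardT; lia.
Qed.

Lemma det_incmx_sqr (F : fieldType) (g : 'I_n -> edge G) : injective g ->
  \det (incmx F g) ^+ 2 = `[< spanning_tree [set g i | i : 'I_n] >]%:R.
Proof.
move=> inj_g; rewrite -(map_incmx intr) det_map_mx -rmorphXn /=.
rewrite det_incmx_sqr_int // rmorph_nat; congr (nat_of_bool _)%:R.
apply: asbool_equiv_eq; split=> [connT|[]//].
by apply: connected_spanning_tree; rewrite ?card_imset ?card_ord.
Qed.

End Incidence.

(** * The dual polynomial as a Gram determinant *)

Section DualPoly.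

Variables (G : mgraph) (F : finFieldType) (I J : {set edge G}).
Let M := #|~: (I :|: J)|.
Let ev (k : 'I_M) : edge G := enum_val k.

Lemma meval_dual_poly (a : 'I_M -> F) :
  meval a (map_mpoly (intr : int -> F) (dual_poly I J)) =
  \sum_(T : {set edge G} | [&& `[< spanning_tree T >], J \subset T
                             & [disjoint T & I]]) \prod_(k | ev k \in T) a k.
Proof.
pose f : {rmorphism mpoly M int -> F} :=
  (meval a \o map_mpoly (intr : int -> F))%FUN.
rewrite -[LHS]/(f (dual_poly I J)) rmorph_sum; apply: eq_bigr => T _.
rewrite rmorph_prod; apply: eq_bigr => k _.
by rewrite /f /= map_mpolyX mevalXU.
Qed.

Lemma sum_spanning_trees (a : 'I_M -> F) : [disjoint I & J] ->
  \sum_(T : {set edge G} | [&& `[< spanning_tree T >], J \subset T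
                             & [disjoint T & I]]) \prod_(k | ev k \in T) a k =
  \sum_(S : {set 'I_M} | `[< spanning_tree (J :|: ev @: S) >])
     \prod_(k in S) a k.
Proof.
move=> dIJ.
have evN k : (ev k \notin I) && (ev k \notin J).
  by have := enum_valP k; rewrite !inE negb_or.
have evS (S : {set 'I_M}) k : (ev k \in J :|: ev @: S) = (k \in S).
  case/andP: (evN k) => _ /negPf kJ.
  by rewrite inE kJ mem_imset //; apply: enum_val_inj.
rewrite (reindex_onto (fun S : {set 'I_M} => J :|: ev @: S)
                      (fun T => [set k | ev k \in T])) /=; last first.
  move=> T /and3P[_ /subsetP sJT dTI]; apply/setP=> e; rewrite !inE.
  have [/sJT-> //|eJ] := boolP (e \in J).
  apply/imsetP/idP => /= [[k]|eT]; first by rewrite inE => kT ->.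
  have eK : e \in ~: (I :|: J).
    by rewrite !inE negb_or eJ (disjointFr dTI eT).
  by exists (enum_rank_in eK e); rewrite ?inE /ev enum_rankK_in.
apply: eq_big => [S | S _]; last by apply: eq_bigl => k; rewrite evS.
rewrite subsetUl /= -andbA; case: asboolP => //= _.
have -> : [set k | ev k \in J :|: ev @: S] = S.
  by apply/setP=> k; rewrite inE evS.
rewrite eqxx andbT; apply/pred0P=> e /=; rewrite !inE.
have [eJ|eJ] := boolP (e \in J); first by rewrite (disjointFl dIJ eJ).
apply/negP => /= /andP[/imsetP[k _ ->]]; apply/negP.
by case/andP: (evN k).
Qed.

Lemma dual_poly_gram j m (p : vert G -> 'I_(j + m).+1) (T0 : {set edge G}) :
  bijective p -> [disjoint I & J] -> #|J| = j ->
  spanning_tree T0 -> J \subset T0 ->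
  exists W : 'M[F]_(M, m), forall a : 'rV[F]_M,
    meval (a 0) (map_mpoly (intr : int -> F) (dual_poly I J)) =
    \det (W^T *m diag_mx a *m W).
Proof.
move=> bij_p dIJ cardJ tree0 sJT0.
have cardK : #|T0 :\: J| = m.
  rewrite cardsD (setIidPr sJT0) (spanning_tree_card bij_p tree0).
  by rewrite cardJ addKn.
pose gJ i := enum_val (cast_ord (esym cardJ) i).
pose gK i := enum_val (cast_ord (esym cardK) i).
have gJ_inj : injective gJ by move=> i1 i2 /enum_val_inj/cast_ord_inj.
have gK_inj : injective gK by move=> i1 i2 /enum_val_inj/cast_ord_inj.
have gJJ i : gJ i \in J by apply: enum_valP.
(* The edges of [J] take the first [j] places, so that [rsubmx] drops their coordinates. *)
pose glue (h : 'I_m -> edge G) i :=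
  match split i with inl i1 => gJ i1 | inr i2 => h i2 end.
have glueP h : injective h -> (forall i, h i \notin J) ->
    injective (glue h) /\
    [set glue h i | i : 'I_(j + m)] = J :|: [set h i | i : 'I_m].
  move=> inj_h hJ; have inj_glue : injective (glue h).
    move=> i1 i2; rewrite /glue -[i1]splitK -[i2]splitK !unsplitK.
    case: (split i1) (split i2) => k1 [] k2.
    - by move=> /gJ_inj->.
    - by move=> E; have := hJ k2; rewrite -E gJJ.
    - by move=> E; have := hJ k1; rewrite E gJJ.
    - by move=> /inj_h->.
  split=> //; apply/eqP; rewrite eqEcard; apply/andP; split.
    apply/subsetP=> _ /imsetP[i _ ->]; rewrite /glue inE.
    by case: (split i) => k; rewrite ?gJJ // imset_f ?orbT.
  rewrite card_imset // card_ord; apply: leq_trans (leq_card_setU _ _) _.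
  by rewrite card_imset // card_ord cardJ.
have [inj0 im0] : injective (glue gK) /\
    [set glue gK i | i : 'I_(j + m)] = T0.
  have [|inj0 ->] := glueP gK gK_inj.
    move=> i; have := enum_valP (cast_ord (esym cardK) i).
    by rewrite inE => /andP[].
  split=> //; apply/eqP; rewrite eqEcard subUset sJT0 /=; apply/andP; split.
    apply/subsetP=> _ /imsetP[i _ ->].
    by have := enum_valP (cast_ord (esym cardK) i); rewrite inE => /andP[].
  rewrite cardsU (disjoint_setI0 _) ?cards0 ?subn0.
    by rewrite card_imset // card_ord cardJ (spanning_tree_card bij_p tree0).
  apply/pred0P=> e /=; apply/andP=> -[eJ /imsetP[i _ De]].
  have := enum_valP (cast_ord (esym cardK) i).
  by rewrite inE -[enum_val _]/(gK i) -De eJ.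
pose B0 := incmx p F (glue gK).
(* The change of basis has determinant 1 up to sign, so it preserves squared minors. *)
have det0 : \det B0 ^+ 2 = 1.
  by rewrite det_incmx_sqr // im0; case: asboolP.
have uB0 : B0 \in unitmx.
  by rewrite unitmxE unitfE -sqrf_eq0 det0 oner_eq0.
pose W : 'M[F]_(M, m) := \matrix_k rsubmx (evec p F (ev k) *m invmx B0).
exists W => a; rewrite meval_dual_poly sum_spanning_trees //.
rewrite (@det_gram _ _ _ W a
    (fun S => `[< spanning_tree (J :|: ev @: S) >]%:R)).
  rewrite [LHS]big_mkcond [RHS]big_mkcond /=; apply: eq_bigr => S _.
  (* A spanning tree has [j + m] edges, so only sets [S] of size [m] contribute. *)
  case: asboolP => [treeS|_]; last by rewrite mul0r if_same.
  have /eqP := spanning_tree_card bij_p treeS.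
  rewrite cardsU (disjoint_setI0 _) ?cards0 ?subn0.
    rewrite card_imset; last exact: enum_val_inj.
    by rewrite cardJ eqn_add2l => ->; rewrite mul1r.
  apply/pred0P=> e /=; apply/andP=> -[eJ /imsetP[k _ De]].
  by have := enum_valP k; rewrite -[enum_val _]/(ev k) -De !inE eJ orbT.
move=> h inj_h; pose g i := ev (h i).
have g_inj : injective g by move=> i1 i2 /enum_val_inj/inj_h.
have gJN i : g i \notin J.
  by have := enum_valP (h i); rewrite !inE negb_or => /andP[].
have [inj_glue im_glue] := glueP g g_inj gJN.
have <- : \det (incmx p F (glue g) *m invmx B0) ^+ 2 =
    `[< spanning_tree (J :|: ev @: [set h i | i : 'I_m]) >]%:R.
  rewrite det_mulmx exprMn det_inv exprVn det0 invr1 mulr1.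
  rewrite det_incmx_sqr // im_glue.
  congr (nat_of_bool (asbool (spanning_tree (_ :|: _))))%:R.
  by rewrite -imset_comp.
congr (_ ^+ 2).
(* The edges of [J] are the first basis vectors, so the upper rows are those of an identity block
   followed by zeros, and only the minor of [W] remains. *)
have -> : incmx p F (glue g) *m invmx B0 =
    block_mx 1%:M 0 (\matrix_i lsubmx (evec p F (g i) *m invmx B0))
      (rowsub h W).
  rewrite /block_mx; apply/row_matrixP=> i; rewrite row_mul rowK /glue.
  rewrite -[i]splitK unsplitK; case: (split i) => k /=.
    rewrite rowKu; have -> : evec p F (gJ k) = row (lshift m k) B0.
      by rewrite rowK /glue -[lshift _ _]/(unsplit (inl k)) unsplitK.
    by rewrite -row_mul mulmxV // (scalar_mx_block j m 1) /block_mx rowKu.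
  by rewrite rowKd row_row_mx row_rowsub !rowK hsubmxK.
by rewrite det_lblock det1 mul1r.
Qed.

End DualPoly.

(** * Divisibility of the number of zeros, and the theorem *)

Lemma nzeros_dual_poly_dvd (F : finFieldType) (G : mgraph) (n : nat)
    (I J : {set edge G}) :
  #|vert G| = n.+1 -> nedges G = (2 * n)%N ->
  [disjoint I & J] -> (#|I| < #|J|)%N -> (#|I| + 3 <= n)%N ->
  (3 <= #|~: (I :|: J)|)%N ->
  (#|F| ^ 3 %| nzeros F (dual_poly I J))%N.
Proof.
move=> cardV cardE dIJ ltIJ leIn ge3.
have cardM : (#|~: (I :|: J)| = 2 * n - #|I| - #|J|)%N.
  rewrite cardsCs setCK cardsU disjoint_setI0 // cards0 subn0.
  by rewrite -[#|edge G|]/(nedges G) cardE subnDA.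
have [[T0 [tree0 sJT0]]|no_tree] :=
    pselect (exists T, spanning_tree T /\ J \subset T); last first.
  (* Without such a tree the polynomial vanishes at every point, and the number of zeros is a power
     of [q] with exponent at least 3. *)
  rewrite /nzeros (_ : [set _ | _] = setT).
    by rewrite cardsT card_ffun card_ord dvdn_exp2l.
  apply/setP=> a; rewrite !inE meval_dual_poly big_pred0 ?eqxx // => T.
  by apply/and3P=> -[/asboolP treeT sJT _]; apply: no_tree; exists T.
pose p0 (x : vert G) := cast_ord cardV (enum_rank x).
have bij_p0 : bijective p0.
  exists (fun i => enum_val (cast_ord (esym cardV) i)) => x.
    by rewrite /p0 cast_ordK enum_rankK.
  by rewrite /p0 enum_valK cast_ordKV.
have cardT := spanning_tree_card bij_p0 tree0.
have leJn : (#|J| <= n)%N by rewrite -cardT subset_leq_card.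
have Dn : n = (#|J| + (n - #|J|))%N by rewrite subnKC.
move: (n - #|J|)%N Dn => m Dn.
move: p0 bij_p0; rewrite Dn => p0 bij_p0.
have [W WP] := dual_poly_gram F bij_p0 dIJ erefl tree0 sJT0.
rewrite /nzeros.
have <- : #|[set a : 'rV[F]_#|~: (I :|: J)| |
      \det (W^T *m diag_mx a *m W) == 0%R]| =
  #|[set a : {ffun 'I_#|~: (I :|: J)| -> F} |
      meval a (map_mpoly (intr : int -> F) (dual_poly I J)) == 0%R]|.
  pose r (a : 'rV[F]_#|~: (I :|: J)|) := [ffun k => a 0 k].
  have inj_r : injective r.
    by move=> a b /ffunP Eab; apply/rowP=> k; have := Eab k; rewrite !ffunE.
  rewrite -(card_imset _ inj_r); apply: eq_card => a.
  apply/imsetP/idP => [[b]|].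
    rewrite !inE -WP => b0 ->; rewrite (meval_eq _ (v2 := b 0)) // => k.
    by rewrite ffunE.
  rewrite inE => a0; exists (\row_k a k); last first.
    by apply/ffunP=> k; rewrite ffunE mxE.
  by rewrite inE -WP (meval_eq _ (v2 := a)) // => k; rewrite mxE.
(* With [M] variables, [M - 2 * m = #|J| - #|I|] and [M - m = n - #|I|]. *)
by apply: card_singular_dvd; rewrite cardM; lia.
Qed.

Theorem proposition33 (R : realType) (G : mgraph) :
  log_divergent G -> (3 <= hgr G)%N -> (3 <= ngr G)%N ->
  (forall I J : {set edge G}, [disjoint I & J] -> (#|I| < #|J|)%N ->
     [\/ ~ connected_graph (subquotient I J),
         planar R (subquotient I J)
       | has_short_cycle (subquotient I J) 3]) ->
  duality_admissible G.
Proof.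
move=> logG h3 n3 _; split=> // F I J dIJ ltIJ leI ge3.
move: logG h3 n3 leI; rewrite /log_divergent /hgr /ngr.
have := @nzeros_dual_poly_dvd F G #|vert G|.-1 I J.
(* An empty vertex set is excluded by [3 <= ngr G]. With [N] edges, [N = 2 * (N - n)] and
   [3 <= N - n] give [N = 2 * n]. *)
case: #|vert G| => [|n] //= H logG h3 n3 leI.
by apply: H => //; lia.
Qed.
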